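(* Let $X_1,\dots,X_N$ be independent real observations with expected values $\mu_1,\dots,\mu_N$ under a hypothesis $\mathcal{H}$ such that each observation is a success, i.e. $X_i>\mu_i$, with probability $P(X_i>\mu_i\mid\mathcal{H})=\tfrac12$ (and otherwise a failure). Assume at least one success is observed. Let an arbitrary weight $w(A_j)$ be associated with each success run $A_j$, and let $T=\max_j w(A_j)$ be the largest weight of any success run. For a fixed value $T_{obs}$, let $P(w_l<T_{obs}\mid l)$ denote the probability of finding a weight $w_l<T_{obs}$ in an individual success run of length $l$. Then $$P(T<T_{obs}\mid N)=\sum_{r=1}^{N}\ \sum_{M=1}^{M_{max}}\ \sum_{\pi}\ \prod_{l}\bigl[P(w_l<T_{obs}\mid l)\bigr]^{n_l}\cdot\frac{(N-r+2-M)_M}{(2^N-1)\cdot\prod_l n_l!},\qquad M_{max}=\min(r,\,N-r+1),$$ where the inner sum is over all integer partitions $\pi$ of $r$ into exactly $M$ positive summands, and $n_l=n_l(\pi)$ is the number of summands of $\pi$ equal to $l$.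
   Context: Observations are ordered by the index $i=1,\dots,N$. A success run is a maximal block of consecutive observations that are all successes; $A_j$ denotes the set of observations in the $j$-th success run, and $w(A_j)$ its weight. $P(T<T_{obs}\mid N)$ is the probability under $\mathcal{H}$ that $T<T_{obs}$ for $N$ observations, given that at least one of them is a success. In the sum, $r$ is the number of successes, $M$ is the number of success runs, and $n_l$ is the number of success runs of length $l$; the products over $l$ range over $l=1,\dots,N$. For positive integers $x,n$, the Pochhammer symbol is $(x)_n=\Gamma(x+n)/\Gamma(x)=(x+n-1)!/(x-1)!$. *)

(* Defs.v *)
From HB Require Import structures.
From mathcomp Require Import all_boot all_order all_algebra.
From mathcomp Require Import all_classical all_reals all_analysis.

Set Implicit Arguments.
Unset Strict Implicit.
Unset Printing Implicit Defensive.

Import Order.TTheory GRing.Theory Num.Theory.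
Import numFieldNormedType.Exports.

Local Open Scope classical_set_scope.
Local Open Scope ring_scope.

Definition cond_prob d (Omega : measurableType d) (R : realType)
    (P : probability Omega R) (E F : set Omega) : R :=
  fine (P (E `&` F)) / fine (P F).

Definition mutually_independent d (Omega : measurableType d) (R : realType)
    (P : probability Omega R) (N : nat) (X : 'I_N -> {RV P >-> R}) : Prop :=
  forall (J : {set 'I_N}) (B : 'I_N -> set R),
    (forall i, measurable (B i)) ->
    P (\bigcap_(i in [set` J]) (X i @^-1` B i)) =
    (\prod_(i in J) P (X i @^-1` B i))%E.

(* A block is a nonempty set of consecutive indices. *)
Definition block (N : nat) (A : {set 'I_N}) : bool :=
  (A != finset.set0) &&
  [forall i in A, forall k in A, forall j : 'I_N,
     ((i <= j)%N && (j <= k)%N) ==> (j \in A)].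

Definition is_success_run (N : nat) (S A : {set 'I_N}) : bool :=
  maxset (fun B : {set 'I_N} => block B && (B \subset S)) A.

Section SuccessRuns.
Context d (Omega : measurableType d) (R : realType) (P : probability Omega R).
Variables (N : nat) (X : 'I_N -> {RV P >-> R}) (mu : 'I_N -> R).

Definition successes (t : Omega) : {set 'I_N} :=
  finset.finset (fun i : 'I_N => mu i < X i t).

Definition some_success : set Omega := [set t | exists i, mu i < X i t].

Definition success_run_event (A : {set 'I_N}) : set Omega :=
  [set t | is_success_run (successes t) A].

(* The observations with index in A, listed by increasing index. *)
Definition observations (A : {set 'I_N}) (t : Omega) : #|A|.-tuple R :=
  [tuple X (enum_val k) t | k < #|A|].

(* A weight is a function of the observations of the run; it may depend on
   which indices the run occupies (e.g. through the mu i). *)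
Variable w : forall A : {set 'I_N}, #|A|.-tuple R -> R.

Definition run_weight (A : {set 'I_N}) (t : Omega) : R :=
  w (observations A t).

(* The value is -oo exactly when there is no success run; on some_success it
   is the maximum of finitely many, and at least one, real weights. *)
Definition max_run_weight (t : Omega) : \bar R :=
  \big[maxe/-oo%E]_(A : {set 'I_N} | is_success_run (successes t) A)
    (run_weight A t)%:E.

End SuccessRuns.

(* An integer partition of r into M positive summands, written in
   nonincreasing order; no summand exceeds r. *)
Definition is_partition (r M : nat) (s : M.-tuple 'I_r.+1) : bool :=
  let parts := map val s in
  [&& sorted geq parts, all (leq 1) parts & sumn parts == r].

Definition multiplicity (r M : nat) (s : M.-tuple 'I_r.+1) (l : nat) : nat :=
  count_mem l (map val s).

(* For positive integers x and n. *)
Definition pochhammer (R : realType) (x n : nat) : R :=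
  ((x + n - 1)`!)%:R / ((x - 1)`!)%:R.

(* Main.v *)
Require Import Defs.
From HB Require Import structures.
From mathcomp Require Import all_boot all_order all_algebra.
From mathcomp Require Import all_classical all_reals all_analysis.
From mathcomp Require Import zify ring.

Import Order.TTheory GRing.Theory Num.Theory.
Import numFieldNormedType.Exports.

Local Open Scope classical_set_scope.
Local Open Scope ring_scope.

(** The possible success patterns are the sets S of indices, all equally likely
    by independence and the success probability one half.  Given S, distinct
    runs occupy disjoint groups of observations, so their weights are
    independent.  That a block A is a run of S only adds failures on the
    boundary of A to the successes on A; this extra condition is independent of
    the observations in A, so it cancels in the conditional probability p #|A|.
    Hence S occurs with all its runs of weight below Tobs with probability
    2^-N times the product of p #|A| over the runs A of S
    ([prob_light_configuration], which rests on [independent_groups]).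
    Conditioning on a success divides by 1 - 2^-N, and there remains to sum
    the product of p #|A| over the nonempty sets S.

    For this, read S as a word of successes and failures.  If S has r elements,
    its N - r failures cut the word into k = N - r + 1 possibly empty stretches
    of successes; their lengths, the gaps of S, are an arbitrary sequence of k
    natural numbers of sum r, and determine S.  The nonzero gaps are the lengths
    of the runs ([prod_runs]).  A partition of r into M parts with n_l parts
    equal to l therefore arises from as many sets as there are rearrangements
    of the multiset made of its parts and k - M zeros, which is the multinomial
    coefficient k! / ((k - M)! * prod_l n_l!) ([sum_given_partition]), and
    k! / (k - M)! is the Pochhammer symbol (k + 1 - M)_M. *)

(** * Rearrangements of a multiset *)

Lemma prod_count_mem (R : comPzSemiRingType) (I : eqType) (f : I -> R)
    (u s : seq I) : uniq u -> {subset s <= u} ->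
  \prod_(x <- s) f x = \prod_(x <- u) f x ^+ count_mem x s.
Proof.
move=> Uu; elim: s => [_|y s IHs sub_su].
  by rewrite big_nil big1 // => x _; rewrite expr0.
have y_u : y \in u by apply: sub_su; rewrite mem_head.
rewrite big_cons IHs => [|x s_x]; last by apply: sub_su; rewrite inE s_x orbT.
rewrite !(bigD1_seq y) //= eqxx exprS mulrA; congr (_ * _).
by apply: eq_bigr => x /negPf; rewrite eq_sym => ->.
Qed.

(** The multinomial count.  A rearrangement of s is some x in s followed by a
    rearrangement of s with one x removed, and removing it divides the product
    of factorials by the multiplicity of x; these multiplicities add up to the
    size of s.  The list u may exceed the support of s because 0! = 1. *)
Lemma size_permutations_mul (I : eqType) (u s : seq I) :
  uniq u -> {subset s <= u} ->
  (size (permutations s) * \prod_(x <- u) (count_mem x s)`! = (size s)`!)%N.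
Proof.
move=> Uu; move En: (size s) => n; elim: n s En => [|n IHn] s.
  by move/size0nil=> -> _; rewrite big1 // => x _; rewrite fact0.
move=> Es sub_su.
have s_gt0 : (0 < size s)%N by rewrite Es.
rewrite (perm_size (permutationsE s_gt0)) size_allpairs_dep sumnE big_map.
rewrite big_distrl /=.
transitivity (\sum_(x <- undup s) (count_mem x s * n`!))%N.
  rewrite big_seq [RHS]big_seq; apply: eq_bigr => x; rewrite mem_undup => s_x.
  rewrite -(IHn (rem x s)); first last.
  - by move=> y /mem_rem; apply: sub_su.
  - by rewrite size_rem // Es.
  rewrite mulnCA; congr (_ * _)%N.
  have x_u := sub_su _ s_x.
  rewrite !(bigD1_seq x) //= mulnA; congr (_ * _)%N; last first.
    apply: eq_bigr => y nyx; have /permP-> := perm_to_rem s_x.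
    by rewrite /= eq_sym (negPf nyx).
  by have /permP-> := perm_to_rem s_x; rewrite /= eqxx add1n factS.
rewrite -big_distrl /= factS -Es; congr (_ * _)%N.
rewrite -sum1_size -(big_undup_iterop_count addn s predT).
apply: eq_bigr => x _.
by rewrite Monoid.iteropE iter_addn_0 mul1n.
Qed.

(** * Success patterns and gaps *)

(** The number of successes immediately before position e in the word b, when
    b is preceded by a further successes. *)
Fixpoint streak (a : nat) (b : bitseq) (e : nat) : nat :=
  if e is e'.+1 then if nth false b e' then (streak a b e').+1 else 0%N else a.

(** The accumulator a counts the successes read since the last failure; the end
    of the word closes the last stretch. *)
Fixpoint gaps (a : nat) (b : bitseq) : seq nat :=
  match b with
  | [::] => [:: a]
  | true :: b' => gaps a.+1 b'
  | false :: b' => a :: gaps 0 b'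
  end.

Lemma streak_cons a x b e :
  streak a (x :: b) e.+1 = streak (if x then a.+1 else 0%N) b e.
Proof. by elim: e => [|e IHe] //=; rewrite -IHe. Qed.

(** Each gap ends at a failure or at the end of the word, the one position where
    [nth false b] reads the default value. *)
Lemma gapsE a b :
  gaps a b =
  [seq streak a b e | e <- iota 0 (size b).+1 & ~~ nth false b e].
Proof.
elim: b a => [|x b IHb] a //; set m := size b.
have step : [seq streak a (x :: b) e | e <- iota 1 m.+1 & ~~ nth false (x :: b) e]
          = gaps (if x then a.+1 else 0%N) b.
  rewrite IHb (iotaDl 1 0) filter_map -map_comp; apply: eq_map => e.
  exact: streak_cons.
have -> : iota 0 (size (x :: b)).+1 = 0%N :: iota 1 m.+1 by [].
by case: x step => /= ->.
Qed.

Lemma size_gaps a b : size (gaps a b) = (count negb b).+1.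
Proof. by elim: b a => [|[] b IHb] a //=; rewrite IHb. Qed.

Lemma sumn_gaps a b : sumn (gaps a b) = (a + count id b)%N.
Proof. by elim: b a => [|[] b IHb] a //=; rewrite IHb ?addnS ?addSn. Qed.

(** Writing each gap x as x successes and a failure restores the word, followed
    by one failure that closes the last gap. *)
Lemma gaps_inj : injective (gaps 0).
Proof.
pose word c := flatten [seq rcons (nseq x true) false | x <- c].
have wordK a b : word (gaps a b) = nseq a true ++ rcons b false.
  elim: b a => [|[] b IHb] a; rewrite /word /= ?cats0 ?cats1 //.
    by rewrite -/(word _) IHb -cat_rcons -[rcons (nseq a _) _]cats1 -(nseqD a 1) addn1.
  by rewrite -/(word _) IHb cat_rcons.
move=> b b' /(congr1 word); rewrite !wordK /= => /eqP.
by rewrite eqseq_rcons => /andP[/eqP].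
Qed.

Lemma gaps_surj a x c : exists b, gaps a b = (a + x)%N :: c.
Proof.
elim: c a x => [|y c IHc] a x.
  exists (nseq x true); elim: x a => [|x IHx] a /=; first by rewrite addn0.
  by rewrite IHx addSnnS.
have [b Eb] := IHc 0%N y; exists (nseq x true ++ false :: b).
by elim: x a => [|x IHx] a /=; rewrite ?Eb ?addn0 // IHx addSnnS.
Qed.

Definition bits (N : nat) (S : {set 'I_N}) : bitseq :=
  [seq i \in S | i <- enum 'I_N].

Definition run_gaps (N : nat) (S : {set 'I_N}) : seq nat := gaps 0 (bits N S).

Lemma size_bits N (S : {set 'I_N}) : size (bits N S) = N.
Proof. by rewrite size_map size_enum_ord. Qed.

Lemma nth_bits N (S : {set 'I_N}) (i : 'I_N) : nth false (bits N S) i = (i \in S).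
Proof. by rewrite (nth_map i) ?size_enum_ord // nth_ord_enum. Qed.

Lemma bits_inj N : injective (bits N).
Proof. by move=> S S' ESS'; apply/setP=> i; rewrite -!nth_bits ESS'. Qed.

Lemma bits_surj N b : size b = N -> exists S, bits N S = b.
Proof.
move=> sb; exists (finset.finset (fun i : 'I_N => nth false b i)).
apply: (@eq_from_nth _ false) => [|i]; rewrite size_bits ?sb // => ltiN.
by rewrite (nth_bits _ _ (Ordinal ltiN)) finset.in_set.
Qed.

Lemma count_bits N (S : {set 'I_N}) : count id (bits N S) = #|S|.
Proof.
rewrite count_map cardE -size_filter; congr size.
by rewrite enumT; apply: eq_filter.
Qed.

Lemma sumn_run_gaps N (S : {set 'I_N}) : sumn (run_gaps N S) = #|S|.
Proof. by rewrite sumn_gaps count_bits. Qed.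

Lemma size_run_gaps N (S : {set 'I_N}) : size (run_gaps N S) = (N - #|S| + 1)%N.
Proof.
rewrite size_gaps addn1 -count_bits -[X in (X - _)%N](size_bits N S).
by rewrite -(count_predC id) addKn.
Qed.

(** The gaps identify the subsets of 'I_N with the sequences c of naturals
    such that sumn c + size c = N.+1, which counts the N observations and the end of
    the word. *)
Lemma card_run_gaps_perm N (c : seq nat) : (sumn c + size c)%N = N.+1 ->
  #|[pred S | perm_eq (run_gaps N S) c]| = size (permutations c).
Proof.
move=> Ec; rewrite cardE -(size_map (run_gaps N)).
apply/perm_size/uniq_perm; last 1 first.
- move=> b; rewrite mem_permutations; apply/mapP/idP => [[S + ->]|perm_bc].
    by rewrite mem_enum.
  have Eb : (sumn b + size b)%N = N.+1.
    by rewrite (perm_sumn perm_bc) (perm_size perm_bc).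
  case: b perm_bc Eb => [|x b] perm_bc Eb //.
  have [v Ev] := gaps_surj 0 x b; rewrite add0n in Ev.
  have [|S ES] := @bits_surj N v.
    apply/eqP; rewrite -eqSS -Eb -Ev sumn_gaps size_gaps addnS eqSS.
    by rewrite -(count_predC id).
  by exists S; rewrite ?mem_enum /run_gaps ?inE ES Ev.
- rewrite map_inj_uniq ?enum_uniq // => S S'.
  by move/gaps_inj/bits_inj.
- exact: permutations_uniq.
Qed.

(** * Runs are the nonzero gaps *)

Lemma blockP N (A : {set 'I_N}) :
  reflect (A != finset.set0 /\ forall i k j : 'I_N, i \in A -> k \in A ->
             (i <= j)%N -> (j <= k)%N -> j \in A) (block A).
Proof.
apply: (iffP andP) => -[A0 convA]; split=> //.
  move=> i k j iA kA ij jk.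
  move/forall_inP: convA => /(_ i iA)/forall_inP/(_ k kA)/forallP/(_ j).
  by rewrite ij jk.
apply/forall_inP=> i iA; apply/forall_inP=> k kA; apply/forallP=> j.
by apply/implyP=> /andP[]; apply: convA.
Qed.

Lemma leq_streak b e : (streak 0 b e <= e)%N.
Proof. by elim: e => [|e IHe] //=; case: ifP. Qed.

Lemma streakP b e i : (e - streak 0 b e <= i)%N -> (i < e)%N -> nth false b i.
Proof.
elim: e => [|e IHe] //=; case: ifP => [be|_]; last by move=> ? ?; lia.
rewrite subSS ltnS => lo; rewrite leq_eqVlt => /orP[/eqP-> //|]; exact: IHe.
Qed.

Lemma streak_max b e i : (forall j, (i <= j)%N -> (j < e)%N -> nth false b j) ->
  (e - i <= streak 0 b e)%N.
Proof.
elim: e => [|e IHe] //= b_i; have [lt_ei|le_ie] := ltnP e i.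
  by rewrite (eqP (_ : e.+1 - i == 0)%N) // subn_eq0.
rewrite b_i // subSn // ltnS; apply: IHe => j ij je.
by apply: b_i => //; apply: ltnW.
Qed.

Definition run_before (N : nat) (S : {set 'I_N}) (e : nat) : {set 'I_N} :=
  finset.finset (fun i : 'I_N => (e - streak 0 (bits N S) e <= i < e)%N).

Lemma card_run_before N (S : {set 'I_N}) e : (e <= N)%N ->
  #|run_before N S e| = streak 0 (bits N S) e.
Proof.
move=> leeN; have le_streak := leq_streak (bits N S) e.
rewrite /run_before; set l := streak _ _ _ in le_streak *.
rewrite -sum1dep_card -(big_mkord (fun i => e - l <= i < e)%N (fun=> 1%N)).
rewrite -big_nat_widen // (@eq_bigl _ _ _ _ _ _ (fun i => true && (e - l <= i)%N)) //.
by rewrite -big_nat_widenl // sum_nat_const_nat muln1 subKn.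
Qed.

Lemma run_before_is_run N (S : {set 'I_N}) (e : 'I_N.+1) :
  ~~ nth false (bits N S) e -> (0 < streak 0 (bits N S) e)%N ->
  is_success_run S (run_before N S e).
Proof.
move=> be l_gt0; have le_le := leq_streak (bits N S) e.
have ltlast : (e.-1 < N)%N by have := ltn_ord e; lia.
apply/maxsetP; split.
  apply/andP; split; last first.
    apply/fintype.subsetP=> i; rewrite finset.in_set -nth_bits => /andP[lo hi].
    exact: streakP lo hi.
  apply/blockP; split.
    apply/set0Pn; exists (Ordinal ltlast); rewrite finset.in_set /=; lia.
  by move=> i k j; rewrite !finset.in_set => /andP[? ?] /andP[? ?] ? ?; lia.
move=> B /andP[/blockP[_ convB] /fintype.subsetP BS] /fintype.subsetP run_sub.
have lastB : Ordinal ltlast \in B by apply: run_sub; rewrite finset.in_set /=; lia.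
apply/eqP; rewrite finset.eqEsubset; apply/andP; split; last exact/fintype.subsetP.
apply/fintype.subsetP=> i iB; rewrite finset.in_set; apply/andP; split.
  have [le_ie|lt_ei] := leqP i e.-1; last by lia.
  suff : (e - i <= streak 0 (bits N S) e)%N by lia.
  apply: streak_max => j ij je.
  have ltjN : (j < N)%N by have := ltn_ord e; lia.
  rewrite (nth_bits _ _ (Ordinal ltjN)); apply: BS.
  by apply: (convB i (Ordinal ltlast)) => //=; lia.
rewrite ltnNge; apply: contra be => lei.
have lteN : (e < N)%N by apply: leq_ltn_trans (ltn_ord i).
rewrite (nth_bits _ _ (Ordinal lteN)); apply: BS.
by apply: (convB (Ordinal ltlast) i) => //=; lia.
Qed.

Lemma max_run_before N (S : {set 'I_N}) (e : 'I_N.+1) :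
  (0 < streak 0 (bits N S) e)%N ->
  (\max_(i in run_before N S e) i.+1)%N = e.
Proof.
move=> l_gt0; have le_le := leq_streak (bits N S) e.
have ltlast : (e.-1 < N)%N by have := ltn_ord e; lia.
apply/eqP; rewrite eqn_leq; apply/andP; split.
  by apply/bigmax_leqP => i; rewrite finset.in_set => /andP[].
apply: (bigop.bigmax_sup (Ordinal ltlast)); rewrite ?finset.in_set /=; lia.
Qed.

(** By maximality: the stretch of successes that ends with the last element of
    A is a block of successes containing A. *)
Lemma run_before_max N (S A : {set 'I_N}) (e := (\max_(i in A) i.+1)%N) :
  is_success_run S A ->
  [/\ (e <= N)%N, ~~ nth false (bits N S) e & run_before N S e = A].
Proof.
move=> /maxsetP[/andP[/blockP[A0 convA] /fintype.subsetP AS] maxA].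
have leeN : (e <= N)%N by apply/bigmax_leqP => i _; apply: ltn_ord.
have [i0 i0A Ee] : {i0 : 'I_N | i0 \in A & e = i0.+1}.
  by apply: (eq_bigmax_cond (fun i : 'I_N => i.+1)); rewrite card_gt0.
have leA i : i \in A -> (i <= i0)%N.
  by move=> iA; rewrite -ltnS -Ee; apply: (leq_bigmax_cond i).
have sub_run : A \subset run_before N S e.
  apply/fintype.subsetP => i iA; have le_i := leA i iA.
  rewrite finset.in_set Ee ltnS le_i andbT -Ee.
  suff : (e - i <= streak 0 (bits N S) e)%N by lia.
  apply: streak_max => j ij je.
  have ltjN : (j < N)%N by lia.
  rewrite (nth_bits _ _ (Ordinal ltjN)); apply: AS.
  by apply: (convA i i0) => //=; lia.
have be : ~~ nth false (bits N S) e.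
  apply/negP => be.
  have lteN : (e < N)%N.
    by rewrite ltnNge; apply: contraL be => leNe; rewrite nth_default ?size_bits.
  rewrite (nth_bits _ _ (Ordinal lteN)) in be.
  have inj : Ordinal lteN \in A; last by have := leA _ inj => /=; lia.
  rewrite -(maxA (Ordinal lteN |: A)) ?finset.setU11 ?finset.subsetUr //.
  apply/andP; split; last by rewrite finset.subUset finset.sub1set be; apply/fintype.subsetP.
  apply/blockP; split; first by apply/set0Pn; exists i0; rewrite !inE i0A orbT.
  move=> i k j; rewrite !inE -!val_eqE /= => iA kA ij jk.
  have [//|nej /=] := eqVneq (j : nat) e.
  have ki : (i <= i0)%N.
    by case/orP: iA => [/eqP ie|/leA //]; case/orP: kA => [/eqP|/leA]; lia.
  have iA' : i \in A by case/orP: iA => // /eqP; lia.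
  case/orP: kA => [/eqP ke|kA]; last exact: (convA i k).
  by apply: (convA i i0); lia.
split=> //; have leeN1 : (e < N.+1)%N by [].
have [] := maxsetP (@run_before_is_run N S (Ordinal leeN1) be _) => /=.
  rewrite -(card_run_before _ _ _ leeN); apply/card_gt0P; exists i0.
  exact: (fintype.subsetP sub_run).
by move=> run_ok _; apply: maxA.
Qed.

(** A run corresponds to the position that follows its last element. *)
Lemma prod_runs (R : comPzSemiRingType) (f : nat -> R) N (S : {set 'I_N}) :
  \prod_(A : {set 'I_N} | is_success_run S A) f #|A| =
  \prod_(x <- run_gaps N S) (if x == 0%N then 1 else f x).
Proof.
rewrite /run_gaps gapsE size_bits big_map big_filter.
rewrite -[iota 0 N.+1]/(index_iota 0 N.+1) big_mkord.
rewrite [RHS](bigID (fun e : 'I_N.+1 => streak 0 (bits N S) e == 0%N)) /=.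
rewrite [X in X * _]big1 ?mul1r; last by move=> e /andP[_ ->].
pose last_end (A : {set 'I_N}) : 'I_N.+1 := inord (\max_(i in A) i.+1)%N.
rewrite (reindex_onto (fun e : 'I_N.+1 => run_before N S e) last_end); last first.
  move=> A /run_before_max[leeN _ EA].
  by rewrite /last_end inordK.
apply: eq_big => [e|e].
  apply/andP/andP => [[run_e /eqP Ee]|[be l0]].
    have [leeN be Erun] := run_before_max _ _ _ run_e.
    rewrite -Ee /last_end inordK //; split=> //.
    rewrite -card_run_before // Erun cards_eq0.
    by have /maxsetp/andP[/blockP[]] := run_e.
  rewrite -lt0n in l0; split; first exact: run_before_is_run.
  by rewrite /last_end max_run_before // inord_val.
have leeN : (e <= N)%N by rewrite -ltnS.
move=> /andP[run_e _]; rewrite card_run_before //.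
have : run_before N S e != finset.set0 by have /maxsetp/andP[/blockP[]] := run_e.
by rewrite -cards_eq0 card_run_before // => /negPf->.
Qed.

(** * Grouping the success patterns by partition *)

(** The partition formed by the nonzero gaps, in nonincreasing order. *)
Definition parts (c : seq nat) : seq nat := sort geq [seq x <- c | (0 < x)%N].

Lemma geq_anti : antisymmetric geq.
Proof. by move=> x y; rewrite /= andbC => /anti_leq. Qed.

Lemma geq_trans : transitive geq.
Proof. by move=> y x z /= yx zy; apply: leq_trans zy yx. Qed.

Lemma perm_parts c :
  perm_eq c (parts c ++ nseq (size c - size (parts c)) 0%N).
Proof.
rewrite perm_sym; apply: (perm_trans _ (permEl (perm_filterC (leq 1) c))).
apply: perm_cat; first by rewrite perm_sort.
set z := seq.filter _ _; suff -> : z = nseq (size z) 0%N.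
  by rewrite size_sort /z !size_filter -(count_predC (leq 1) c) addKn.
apply/all_pred1P/allP=> x; rewrite mem_filter /= => /andP[].
by rewrite -eqn0Ngt.
Qed.

Lemma parts_perm c c' : perm_eq c c' -> parts c = parts c'.
Proof.
move=> cc'; apply: (sorted_eq geq_trans geq_anti).
- by apply: sort_sorted => x y; apply: leq_total.
- by apply: sort_sorted => x y; apply: leq_total.
- by rewrite perm_sort perm_sym perm_sort perm_sym perm_filter.
Qed.

Lemma parts_pad s n : sorted geq s -> all (leq 1) s ->
  parts (s ++ nseq n 0%N) = s.
Proof.
move=> s_sorted s_pos; rewrite /parts filter_cat filter_nseq cats0.
have /all_filterP-> : all (fun x => 0 < x)%N s by [].
by apply: sorted_sort s_sorted; apply: geq_trans.
Qed.

(** The tuple that represents [parts c], when c has sum r and M nonzero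
    terms; [inord] and the default value of [nth] only matter otherwise. *)
Definition partition_code (r M : nat) (c : seq nat) : M.-tuple 'I_r.+1 :=
  [tuple inord (nth 0%N (parts c) i) | i < M].

Lemma val_partition_code r M c : sumn c = r -> size (parts c) = M ->
  map val (partition_code r M c) = parts c.
Proof.
move=> sum_c size_c; apply: (@eq_from_nth _ 0%N).
  by rewrite size_map size_tuple.
move=> i; rewrite size_map size_tuple => ltiM.
rewrite (nth_map ord0) ?size_tuple // -(tnth_nth _ _ (Ordinal ltiM)).
rewrite tnth_mktuple /= inordK // ltnS.
have : nth 0%N (parts c) i \in c.
  have : nth 0%N (parts c) i \in parts c by rewrite mem_nth ?size_c.
  by rewrite mem_sort mem_filter => /andP[].
rewrite -sum_c => /perm_to_rem/perm_sumn->; exact: leq_addr.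
Qed.

(** Grouping sequences by sum, number of nonzero terms and partition is
    grouping them by their class up to rearrangement, represented by the parts
    followed by zeros; the classes can then be counted as multisets. *)
Lemma partition_codeE r M (s : M.-tuple 'I_r.+1) c n :
  is_partition s -> size c = (M + n)%N ->
  perm_eq c (map val s ++ nseq n 0%N) =
    [&& sumn c == r, size (parts c) == M & partition_code r M c == s].
Proof.
move=> /and3P[s_sorted s_pos /eqP s_sum] size_c.
apply/idP/and3P => [perm_c|[/eqP sum_c /eqP size_parts /eqP <-]].
  have Ec : parts c = map val s by rewrite (parts_perm _ _ perm_c) parts_pad.
  have sum_c : sumn c = r.
    by rewrite (perm_sumn perm_c) sumn_cat s_sum sumn_nseq mul0n addn0.
  have sz_c : size (parts c) = M by rewrite Ec size_map size_tuple.
  split; apply/eqP=> //; apply: val_inj; apply: (inj_map val_inj).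
  by rewrite /= val_partition_code.
rewrite val_partition_code //.
by have := perm_parts c; rewrite size_parts size_c addKn.
Qed.

Lemma partition_code_is_partition r M c : sumn c = r -> size (parts c) = M ->
  is_partition (partition_code r M c).
Proof.
move=> sum_c size_c; rewrite /is_partition val_partition_code //.
apply/and3P; split.
- by apply: sort_sorted => x y; apply: leq_total.
- by apply/allP=> x; rewrite mem_sort mem_filter => /andP[].
- by rewrite -sum_c (perm_sumn (perm_parts c)) sumn_cat sumn_nseq mul0n addn0.
Qed.

Lemma leq_size_parts c : (size (parts c) <= minn (sumn c) (size c))%N.
Proof.
rewrite /parts size_sort leq_min size_filter count_size andbT.
by elim: c => [|[|x] c IHc] //=; rewrite addSn ltnS (leq_trans IHc) ?leq_addl.
Qed.

Section CountRuns.
Variables (R : realType) (p : nat -> R).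

(** Empty stretches are not runs, so they contribute the factor 1. *)
Definition gap_weight (x : nat) : R := if x == 0%N then 1 else p x.

(** All terms of the sum are equal, and their number is the multinomial
    coefficient of a multiset with N - r + 1 - M zeros. *)
Lemma sum_given_partition N r M (s : M.-tuple 'I_r.+1) :
  (0 < r <= N)%N -> (M <= N - r + 1)%N -> is_partition s ->
  \sum_(S | perm_eq (run_gaps N S) (map val s ++ nseq (N - r + 1 - M) 0%N))
     \prod_(x <- run_gaps N S) gap_weight x =
  (\prod_(1 <= l < N.+1) p l ^+ multiplicity s l) *
  (pochhammer R (N - r + 2 - M) M /
     \prod_(1 <= l < N.+1) ((multiplicity s l)`!)%:R).
Proof.
move=> /andP[r_gt0 le_rN] le_M /and3P[s_sorted s_pos /eqP s_sum].
set c := _ ++ _; set u := index_iota 0 N.+1.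
have Uu : uniq u by apply: iota_uniq.
have sum_c : sumn c = r by rewrite sumn_cat s_sum sumn_nseq mul0n addn0.
have size_c : size c = (N - r + 1)%N.
  by rewrite size_cat size_map size_tuple size_nseq subnKC.
have sub_cu : {subset c <= u}.
  move=> x xc; rewrite mem_index_iota leq0n ltnS.
  apply: leq_trans le_rN; rewrite -sum_c (perm_sumn (perm_to_rem xc)).
  exact: leq_addr.
have count_c l : (0 < l)%N -> count_mem l c = multiplicity s l.
  by case: l => // l _; rewrite count_cat count_nseq mul0n addn0.
have count0 : count_mem 0%N c = (N - r + 1 - M)%N.
  rewrite count_cat count_nseq mul1n (@eq_in_count _ _ pred0) ?count_pred0 //.
  by move=> x xs; have /allP/(_ x xs) := s_pos; case: x xs.
transitivity (\sum_(S | perm_eq (run_gaps N S) c) \prod_(x <- c) gap_weight x).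
  by apply: eq_bigr => S Sc; apply: perm_big.
rewrite sumr_const card_run_gaps_perm; last by rewrite sum_c size_c; lia.
rewrite -[LHS]mulr_natr; congr (_ * _).
  rewrite (prod_count_mem _ _ _ _ _ Uu sub_cu) /u [LHS]big_ltn // {1}/gap_weight eqxx expr1n mul1r.
  by apply: eq_big_nat => -[|l] // _; rewrite count_c.
have Hperm := size_permutations_mul _ _ _ Uu sub_cu.
rewrite /u big_ltn // count0 in Hperm; move: Hperm.
rewrite (eq_big_nat _ _ (F2 := fun l => (multiplicity s l)`!)); last first.
  by move=> l /andP[l_gt0 _]; rewrite count_c.
rewrite size_c => /(congr1 (fun n => n%:R : R)).
rewrite !natrM natr_prod; set Q := \prod_(_ <= _ < _) _ => Hperm.
have Q0 : Q != 0.
  by rewrite /Q prodf_seq_neq0; apply/allP=> l _; rewrite pnatr_eq0 -lt0n fact_gt0.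
rewrite /pochhammer.
have -> : (N - r + 2 - M + M - 1 = N - r + 1)%N by lia.
have -> : (N - r + 2 - M - 1 = N - r + 1 - M)%N by lia.
rewrite -Hperm; field; rewrite Q0 /= pnatr_eq0 -lt0n fact_gt0 //.
Qed.

Lemma partition_big_seq (I : finType) (J : eqType) (u : seq J) (P : pred I)
    (h : I -> J) (F : I -> R) :
  uniq u -> (forall i, P i -> h i \in u) ->
  \sum_(i | P i) F i = \sum_(j <- u) \sum_(i | P i && (h i == j)) F i.
Proof.
move=> Uu h_u; rewrite (exchange_big_dep P) /=; last by move=> j i _ /andP[].
apply: eq_bigr => i Pi.
rewrite (eq_bigl (pred1 (h i))); last by move=> j; rewrite /= Pi eq_sym.
by rewrite -big_filter filter_pred1_uniq ?h_u // big_seq1.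
Qed.

Lemma sum_nonempty_sets N :
  \sum_(S : {set 'I_N} | S != finset.set0)
     \prod_(A : {set 'I_N} | is_success_run S A) p #|A| =
  \sum_(1 <= r < N.+1) \sum_(1 <= M < (minn r (N - r + 1)).+1)
    \sum_(s : M.-tuple 'I_r.+1 | is_partition s)
      (\prod_(1 <= l < N.+1) p l ^+ multiplicity s l) *
      (pochhammer R (N - r + 2 - M) M /
         \prod_(1 <= l < N.+1) ((multiplicity s l)`!)%:R).
Proof.
under eq_bigr do rewrite prod_runs.
rewrite (partition_big_seq _ _ (index_iota 1 N.+1) _ (fun S : {set 'I_N} => #|S|)) ?iota_uniq //; last first.
  move=> S S0; rewrite mem_index_iota card_gt0 S0 ltnS.
  by rewrite -[X in (_ <= X)%N](card_ord N) max_card.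
apply: eq_big_nat => r /andP[r_gt0 le_rN].
rewrite (partition_big_seq _ _ (index_iota 1 (minn r (N - r + 1)).+1) _
           (fun S : {set 'I_N} => size (parts (run_gaps N S)))) ?iota_uniq //; last first.
  move=> S /andP[S0 /eqP cardS]; rewrite mem_index_iota.
  have := leq_size_parts (run_gaps N S).
  rewrite sumn_run_gaps size_run_gaps cardS ltnS => ->; rewrite andbT.
  rewrite lt0n; apply: contraTneq r_gt0 => size0.
  rewrite -cardS -sumn_run_gaps (perm_sumn (perm_parts (run_gaps N S))).
  by rewrite (size0nil size0) sumn_nseq.
apply: eq_big_nat => M /andP[M_gt0]; rewrite ltnS leq_min => /andP[_ le_M].
rewrite (partition_big (fun S : {set 'I_N} => partition_code r M (run_gaps N S))
           (@is_partition r M)); last first.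
  move=> S /andP[/andP[S0 /eqP cardS] /eqP sizeS].
  by apply: partition_code_is_partition => //; rewrite sumn_run_gaps.
apply: eq_bigr => s s_part.
rewrite -sum_given_partition ?r_gt0 //; apply: eq_bigl => S.
have [cardS|cardS] := eqVneq #|S| r; last first.
  rewrite andbF /=; apply/esym/negbTE; apply: contra cardS => /perm_sumn.
  rewrite sumn_run_gaps sumn_cat sumn_nseq mul0n addn0 => ->.
  by have /and3P[] := s_part.
rewrite (partition_codeE _ _ _ _ (N - r + 1 - M)) //; last first.
  by rewrite size_run_gaps cardS subnKC.
by rewrite sumn_run_gaps cardS eqxx -card_gt0 cardS r_gt0.
Qed.

End CountRuns.

(** * Independence of disjoint groups of observations *)

Section TupleBoxes.
Variables (R : realType) (n : nat).

Definition box (B : 'I_n -> set R) : set (n.-tuple R) :=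
  [set x | forall k, B k (tnth x k)].

Definition measurable_box : set (set (n.-tuple R)) :=
  [set D | exists2 B, forall k, measurable (B k) & D = box B].

Lemma box_measurable B : (forall k, measurable (B k)) -> measurable (box B).
Proof.
move=> mB; have -> : box B = \bigcap_(k in [set: 'I_n]) ((@tnth n R)^~ k @^-1` B k).
  by apply/seteqP; split=> [x Bx k _|x Bx k]; [apply: Bx|apply: (Bx k)].
apply: fin_bigcap_measurable => // k _.
by rewrite -[X in measurable X]setTI; apply: measurable_tnth.
Qed.

Lemma measurable_tupleE :
  @measurable _ (n.-tuple R) = <<s measurable_box >>.
Proof.
apply/seteqP; split; last first.
  apply: smallest_sub; first exact: sigma_algebra_measurable.
  by move=> _ [B mB ->]; apply: box_measurable.
apply: smallest_sub; first exact: smallest_sigma_algebra.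
rewrite -bigcup_seq; apply: bigcup_sub => k _ _ [C mC <-].
apply: sub_sigma_algebra; exists (fun i => if i == k then C else setT).
  by move=> i; case: ifP.
apply/seteqP; split=> [x [_ Cx] i|x Bx] /=; first by case: eqP => [->|].
by split=> //; have := Bx k; rewrite eqxx.
Qed.

Lemma measurable_box_setI : setI_closed measurable_box.
Proof.
move=> _ _ [B mB ->] [C mC ->]; exists (fun k => B k `&` C k).
  by move=> k; apply: measurableI.
apply/seteqP; split=> [x [Bx Cx] k|x BCx]; first by split.
by split=> k; have [] := BCx k.
Qed.

(** Both sides are additive in D, so the identity extends from the boxes, which
    are stable under intersection and generate the measurable sets of tuples, by
    Dynkin's lemma. *)
Lemma independent_of_tuple d (Omega : measurableType d) (P : probability Omega R)
    (G : set Omega) (f : Omega -> n.-tuple R) :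
  measurable G -> measurable_fun setT f ->
  (forall B, (forall k, measurable (B k)) ->
     P (G `&` f @^-1` box B) = (P G * P (f @^-1` box B))%E) ->
  forall D, measurable D -> P (G `&` f @^-1` D) = (P G * P (f @^-1` D))%E.
Proof.
move=> mG mf indep_box D mD.
have mpre C : measurable C -> measurable (f @^-1` C).
  by move=> mC; rewrite -[X in measurable X]setTI; apply: mf.
have PG : P G = (fine (P G))%:E by rewrite fineK // fin_num_measure.
pose indep (C : set (n.-tuple R)) := P (G `&` f @^-1` C) = (P G * P (f @^-1` C))%E.
rewrite measurable_tupleE in mD.
apply: (@dynkin_induction _ _ measurable_box indep measurable_tupleE
          measurable_box_setI _ _ _ _ D mD).
- by rewrite /indep preimage_setT setIT probability_setT mule1.
- by move=> _ [B mB ->]; apply: indep_box.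
- move=> C mC; rewrite /indep => IC.
  have -> : f @^-1` (~` C) = ~` (f @^-1` C) by [].
  rewrite -setDE.
  have mfC := mpre _ mC.
  rewrite measureD //; last by rewrite ltey_eq fin_num_measure.
  rewrite [X in (_ - X)%E]IC probability_setC // PG muleBr ?mule1 //.
  by rewrite -PG.
- move=> F mF tF IF; rewrite /indep preimage_bigcup setI_bigcupr.
  have tpre : trivIset setT (fun k => f @^-1` F k).
    move=> i j _ _ [t [Fit Fjt]]; apply: (tF i j) => //.
    by exists (f t).
  have tG : trivIset setT (fun k => G `&` f @^-1` F k).
    by move=> i j _ _ [t [[_ Fit] [_ Fjt]]]; apply: (tpre i j) => //; exists t.
  have mfF k : measurable (f @^-1` F k) by apply: mpre.
  have mGF k : measurable (G `&` f @^-1` F k) by apply: measurableI.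
  rewrite measure_semi_bigcup //; last exact: bigcup_measurable.
  rewrite measure_semi_bigcup //; last exact: bigcup_measurable.
  by rewrite PG -nneseriesZl // -PG; apply: eq_eseriesr => k _; apply: IF.
Qed.

End TupleBoxes.

Section Observations.
Context d (Omega : measurableType d) (R : realType) (P : probability Omega R).
Variables (N : nat) (X : 'I_N -> {RV P >-> R}).

Lemma measurable_observations (A : {set 'I_N}) :
  measurable_fun setT (observations X A).
Proof.
apply/measurable_fun_tnthP => k.
rewrite (_ : _ \o _ = X (enum_val k)) //.
by apply/funext => t /=; rewrite tnth_mktuple.
Qed.

Lemma coordinates_measurable (J : {set 'I_N}) (B : 'I_N -> set R) :
  (forall i, measurable (B i)) ->
  measurable (\bigcap_(i in [set` J]) (X i @^-1` B i)).
Proof.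
move=> mB; apply: fin_bigcap_measurable => // i _.
exact: measurable_funPTI.
Qed.

Hypothesis X_indep : mutually_independent X.

(** Induction on the groups As, for all J and B at once: for a box D A, the
    event that the observations in A lie in D A can be moved into the conditions
    on single observations, by enlarging J by A; [independent_of_tuple] then
    gives every measurable D A. *)
Lemma independent_groups (D : forall A : {set 'I_N}, set (#|A|.-tuple R))
    (As : seq {set 'I_N}) (J : {set 'I_N}) (B : 'I_N -> set R) :
  (forall A, A \in As -> measurable (D A)) -> (forall i, measurable (B i)) ->
  pairwise (fun A A' : {set 'I_N} => [disjoint A & A']%B) As ->
  all (fun A : {set 'I_N} => [disjoint A & J]%B) As ->
  P ((\big[setI/setT]_(A <- As) (observations X A @^-1` D A)) `&`
     \bigcap_(i in [set` J]) (X i @^-1` B i)) =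
  (\prod_(A <- As) P (observations X A @^-1` D A) *
   \prod_(i in J) P (X i @^-1` B i))%E.
Proof.
elim: As J B => [|A As IHAs] J B mD mB /=.
  by move=> _ _; rewrite !big_nil setTI mul1e X_indep.
move=> /andP[disjA disjAs] /andP[disjAJ disjJ].
have mDA : measurable (D A) by apply: mD; rewrite mem_head.
have {}mD A' : A' \in As -> measurable (D A').
  by move=> A'As; apply: mD; rewrite inE A'As orbT.
rewrite !big_cons; set E := \big[setI/setT]_(_ <- As) _.
rewrite -setIA setIC; set G := E `&` _.
have mobs A' C : measurable C -> measurable (observations X A' @^-1` C).
  by move=> mC; rewrite -[X in measurable X]setTI; apply: measurable_observations.
have mE : measurable E.
  by rewrite /E big_seq; apply: bigsetI_measurable => A' A'As; apply: mobs; apply: mD.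
have mG : measurable G by apply: measurableI => //; apply: coordinates_measurable.
suff indep_box C : (forall k, measurable (C k)) ->
    P (G `&` observations X A @^-1` box _ _ C) =
    (P G * P (observations X A @^-1` box _ _ C))%E.
  rewrite (independent_of_tuple _ _ _ _ _ _ _ mG (measurable_observations A)
             indep_box _ mDA).
  by rewrite /G IHAs // muleC muleA.
move=> mC.
(* For i in A, exactly one k has enum_val k = i; taking the intersection over
   such k avoids choosing it. *)
pose B' i := if i \in A then \bigcap_(k in [set k | enum_val k = i]) C k else B i.
have mB' i : measurable (B' i).
  rewrite /B'; case: ifP => // _; apply: fin_bigcap_measurable => // k _; exact: mC.
have box_coord : observations X A @^-1` box _ _ C =
    \bigcap_(i in [set` A]) (X i @^-1` B' i).
  apply/seteqP; split=> [t Ct i /= iA|t Ct k].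
    by rewrite /B' iA => k /= <-; have := Ct k; rewrite tnth_mktuple.
  rewrite tnth_mktuple; have /= := Ct (enum_val k) (enum_valP k).
  by rewrite /B' enum_valP; apply.
have BB' : \bigcap_(i in [set` J]) (X i @^-1` B i) =
           \bigcap_(i in [set` J]) (X i @^-1` B' i).
  apply: eq_bigcapr => i /= iJ; rewrite /B'.
  by rewrite (negPf (_ : i \notin A)) // (disjointFl disjAJ iJ).
rewrite /G box_coord -setIA BB'.
have -> : \bigcap_(i in [set` J]) (X i @^-1` B' i) `&`
          \bigcap_(i in [set` A]) (X i @^-1` B' i) =
          \bigcap_(i in [set` A :|: J]) (X i @^-1` B' i).
  apply/seteqP; split=> [t [tJ tA] i /=|t tAJ].
    by rewrite inE => /orP[iA|iJ]; [apply: tA|apply: tJ].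
  by split=> i /= i_in; apply: tAJ; rewrite /= inE i_in ?orbT.
rewrite !IHAs //; last first.
  apply/allP=> A' A'As; rewrite -finset.setI_eq0 finset.setIUr finset.setU_eq0.
  rewrite !finset.setI_eq0 disjoint_sym (allP disjA A' A'As).
  exact: (allP disjJ A' A'As).
rewrite X_indep // (eq_bigl [predU A & J]); last by move=> i; rewrite !inE.
by rewrite bigU // [X in (_ * X = _)%E]muleC muleA.
Qed.

End Observations.

(** * Runs as blocks with failures on the boundary *)

(** For a block A, these are the at most two indices adjacent to A. *)
Definition boundary (N : nat) (A : {set 'I_N}) : {set 'I_N} :=
  finset.finset (fun j : 'I_N => (j \notin A) && block (j |: A)).

Lemma disjoint_boundary N (A : {set 'I_N}) : [disjoint A & boundary N A]%B.
Proof.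
rewrite disjoint_sym; apply/pred0P => j /=; rewrite finset.in_set.
by case: (j \in A); rewrite ?andbF.
Qed.

(** The element of B outside A that is closest to a fixed element of A is
    adjacent to A. *)
Lemma block_neighbour N (A B : {set 'I_N}) : block A -> block B ->
  A \subset B -> A != B -> exists2 j, j \in B & j \in boundary N A.
Proof.
move=> /blockP[A0 convA] /blockP[_ convB] /fintype.subsetP AB neqAB.
have [a aA] := set0Pn _ A0.
have [i0 i0B i0A] : exists2 i, i \in B & i \notin A.
  apply/fintype.subsetPn; apply: contra neqAB => BA.
  by rewrite finset.eqEsubset BA andbT; apply/fintype.subsetP.
pose D (i : 'I_N) : nat := ((i - a) + (a - i))%N.
have Pi0 : (i0 \in B) && (i0 \notin A) by rewrite i0B.
case: (@arg_minnP _ i0 (fun i => (i \in B) && (i \notin A)) D Pi0) => j /andP[jB jA] minj.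
exists j => //; rewrite finset.in_set jA /=.
have closer (z : 'I_N) : z \in B -> (D z < D j)%N -> z \in A.
  move=> zB lt_zj; apply: contraLR lt_zj => zA.
  by rewrite -leqNgt minj // zB.
have neja : (j : nat) <> a by move=> /val_inj Eja; rewrite Eja aA in jA.
have jx (x z : 'I_N) : x \in A ->
  ((j <= z)%N && (z <= x)%N) || ((x <= z)%N && (z <= j)%N) -> (z == j) || (z \in A).
  move=> xA /orP[] /andP[lo hi]; have [//|nzj /=] := eqVneq z j.
    have {nzj} ltjz : (j < z)%N by rewrite ltn_neqAle eq_sym nzj.
    have [le_az|lt_za] := leqP a z; first exact: (convA a x).
    by apply: closer; [apply: (convB j x) => //; apply: AB|rewrite /D; lia].
  have {nzj} ltzj : (z < j)%N by rewrite ltn_neqAle nzj.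
  have [le_za|lt_az] := leqP z a; first exact: (convA x a).
  by apply: closer; [apply: (convB x j) => //; apply: AB|rewrite /D; lia].
apply/blockP; split; first by apply/set0Pn; exists j; rewrite !inE eqxx.
move=> x y z; rewrite !inE => /orP[/eqP->|xA] /orP[/eqP->|yA] xz zy.
- by apply/orP; left; apply/eqP/val_inj/eqP; rewrite /= eqn_leq zy.
- by apply: (jx y) => //; rewrite xz zy.
- by apply: (jx x) => //; rewrite xz zy orbT.
- by rewrite (convA x y) ?orbT.
Qed.

(** This turns the maximality of a run into conditions on single observations,
    outside of A for the failures. *)
Lemma is_success_runE N (S A : {set 'I_N}) : block A ->
  is_success_run S A = (A \subset S) && [disjoint boundary N A & S]%B.
Proof.
move=> blockA; apply/maxsetP/andP => [[/andP[_ AS] maxA]|[AS disjAS]].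
  split=> //; apply/pred0P => j /=; rewrite finset.in_set.
  apply/negP => /andP[/andP[jA blockjA] jS].
  have := maxA (j |: A); rewrite blockjA finset.subUset finset.sub1set jS AS finset.subsetUr.
  by move=> /(_ isT isT) E; rewrite -E finset.setU11 in jA.
split=> [|B /andP[blockB BS] AB]; first by rewrite blockA.
apply/eqP; apply: contraT => neqBA.
have [|j jB jbd] := block_neighbour _ _ _ blockA blockB AB; first by rewrite eq_sym.
by have := fintype.subsetP BS j jB; rewrite (disjointFr disjAS jbd).
Qed.

Lemma blockU N (A B : {set 'I_N}) (i : 'I_N) : block A -> block B ->
  i \in A -> i \in B -> block (A :|: B).
Proof.
move=> /blockP[_ convA] /blockP[_ convB] iA iB; apply/blockP; split.
  by apply/set0Pn; exists i; rewrite inE iA.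
move=> x y z; rewrite !inE => xAB yAB xz zy.
have [le_zi|/ltnW le_iz] := leqP z i.
  by case/orP: xAB => xin; [rewrite (convA x i)|rewrite (convB x i) ?orbT].
by case/orP: yAB => yin; [rewrite (convA i y)|rewrite (convB i y) ?orbT].
Qed.

Lemma disjoint_runs N (S A B : {set 'I_N}) :
  is_success_run S A -> is_success_run S B -> A != B -> [disjoint A & B]%B.
Proof.
move=> /maxsetP[/andP[blockA AS] maxA] /maxsetP[/andP[blockB BS] maxB].
apply: contraNT => /pred0Pn[i /andP[iA iB]].
have UP : block (A :|: B) && (A :|: B \subset S).
  by rewrite (blockU _ _ _ i) // finset.subUset AS BS.
by rewrite -(maxA _ UP) ?finset.subsetUl // (maxB _ UP) ?finset.subsetUr.
Qed.

Lemma success_in_run N (S : {set 'I_N}) (i : 'I_N) : i \in S ->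
  exists2 A : {set 'I_N}, is_success_run S A & i \in A.
Proof.
move=> iS.
have [|A runA /fintype.subsetP sub_iA] :=
    @maxset_exists _ (fun B => block B && (B \subset S)) (finset.set1 i).
  rewrite finset.sub1set iS andbT; apply/blockP; split.
    by apply/set0Pn; exists i; rewrite finset.set11.
  move=> x y z /finset.set1P-> /finset.set1P-> iz zi.
  by apply/finset.set1P/val_inj/eqP; rewrite /= eqn_leq zi.
by exists A => //; apply: sub_iA; rewrite finset.set11.
Qed.

(** * Probability of a success pattern with light runs *)

Section Configurations.
Context d (Omega : measurableType d) (R : realType) (P : probability Omega R).
Variables (N : nat) (X : 'I_N -> {RV P >-> R}) (mu : 'I_N -> R).
Variable w : forall A : {set 'I_N}, #|A|.-tuple R -> R.
Variables (Tobs : R) (p : nat -> R).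

Hypothesis X_indep : mutually_independent X.
Hypothesis X_success : forall i, P [set t | mu i < X i t] = (2^-1)%:E.
Hypothesis w_meas : forall A : {set 'I_N}, block A -> measurable_fun setT (w A).
Hypothesis p_def : forall A : {set 'I_N}, block A ->
  cond_prob P [set t | run_weight X w A t < Tobs]
              (success_run_event X mu A) = p #|A|.

Definition success_values (i : 'I_N) : set R := [set x | mu i < x].
Definition failure_values (i : 'I_N) : set R := [set x | x <= mu i].

Lemma measurable_success_values i : measurable (success_values i).
Proof.
rewrite (_ : success_values i = `]mu i, +oo[%classic) //.
by apply/seteqP; split=> x /=; rewrite in_itv /= andbT.
Qed.

Lemma measurable_failure_values i : measurable (failure_values i).
Proof. by rewrite (_ : failure_values i = `]-oo, mu i]%classic). Qed.

Lemma prob_failure i : P (X i @^-1` failure_values i) = (2^-1)%:E.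
Proof.
have -> : X i @^-1` failure_values i = ~` (X i @^-1` success_values i).
  by apply/seteqP; split=> t; rewrite /failure_values /success_values /= leNgt => /negP.
rewrite probability_setC; last by apply: measurable_funPTI; apply: measurable_success_values.
by rewrite [P _]X_success -EFinB [X in (X - _)%:E](splitr 1) div1r addrK.
Qed.

Lemma prod_half (J : {set 'I_N}) (B : 'I_N -> set R) :
  (forall i, i \in J -> P (X i @^-1` B i) = (2^-1)%:E) ->
  (\prod_(i in J) P (X i @^-1` B i))%E = (2^-1 ^+ #|J|)%:E.
Proof. by move=> B_half; rewrite (eq_bigr _ B_half) prodEFin prodr_const. Qed.

Definition light_values (A : {set 'I_N}) : set (#|A|.-tuple R) :=
  box R #|A| (fun k => success_values (enum_val k)) `&`
  w A @^-1` [set x | x < Tobs].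

Lemma measurable_light_values A : block A -> measurable (light_values A).
Proof.
move=> blockA; apply: measurableI.
  by apply: box_measurable => k; apply: measurable_success_values.
rewrite -[X in measurable X]setTI; apply: w_meas => //.
by rewrite (_ : mkset _ = `]-oo, Tobs[%classic).
Qed.

Lemma box_successes (A : {set 'I_N}) t :
  box R #|A| (fun k => success_values (enum_val k)) (observations X A t) <->
  A \subset successes X mu t.
Proof.
split=> [box_t|/fintype.subsetP AS k].
  apply/fintype.subsetP => i iA; rewrite finset.in_set.
  have := box_t (enum_rank_in iA i).
  by rewrite tnth_mktuple enum_rankK_in.
rewrite tnth_mktuple /success_values /=.
by have := AS _ (enum_valP k); rewrite finset.in_set.
Qed.

Lemma coordinates_failures (J : {set 'I_N}) t :
  (\bigcap_(i in [set` J]) (X i @^-1` failure_values i)) t <->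
  [disjoint J & successes X mu t]%B.
Proof.
split=> [fail_t|disj i /= iJ].
  apply/pred0P => i /=; rewrite finset.in_set; apply/negP => /andP[iJ].
  by rewrite ltNge => /negP; apply; apply: fail_t.
have := disjointFr disj iJ; rewrite finset.in_set /failure_values /=.
by rewrite ltNge => /negbFE.
Qed.

(** The failures on the boundary that make A a run are independent of the
    observations in A, so their probability cancels in the quotient that
    defines p #|A|; the remaining factor is the probability 2^-#|A| of a success
    throughout A. *)
Lemma prob_light A : block A ->
  P (observations X A @^-1` light_values A) = (p #|A| * 2^-1 ^+ #|A|)%:E.
Proof.
move=> blockA; have mA := measurable_light_values A blockA.
set E := _ @^-1` _.
have mE : measurable E.
  by rewrite -[X in measurable X]setTI; apply: measurable_observations.
pose C := \bigcap_(i in [set` boundary N A]) (X i @^-1` failure_values i).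
have runE : success_run_event X mu A =
    [set t | box R #|A| (fun k => success_values (enum_val k)) (observations X A t)] `&` C.
  apply/seteqP; split=> t; rewrite /success_run_event /= is_success_runE //.
    by move=> /andP[/box_successes boxA /coordinates_failures].
  by move=> [/box_successes-> /coordinates_failures->].
have lightE : [set t | run_weight X w A t < Tobs] `&` success_run_event X mu A =
    E `&` C.
  rewrite runE; apply/seteqP.
  by split=> [t [light_t [box_t Ct]]|t [[box_t light_t] Ct]]; do !split.
have P_light : P (E `&` C) = (fine (P E) * 2^-1 ^+ #|boundary N A|)%:E.
  have := independent_groups _ _ _ P N X X_indep light_values [:: A] (boundary N A)
    failure_values.
  rewrite !big_seq1 => ->.
  - rewrite prod_half => [|i _]; last exact: prob_failure.
    by rewrite EFinM fineK // fin_num_measure.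
  - by move=> A' /[!inE] /eqP->.
  - exact: measurable_failure_values.
  - by [].
  - by rewrite /= disjoint_boundary.
have P_run : P (success_run_event X mu A) =
    (2^-1 ^+ #|A| * 2^-1 ^+ #|boundary N A|)%:E.
  pose B i := if i \in A then success_values i else failure_values i.
  have -> : success_run_event X mu A =
      \bigcap_(i in [set` A :|: boundary N A]) (X i @^-1` B i).
    rewrite runE; apply/seteqP; split=> [t [/box_successes AS Ct] i /=|t Bt].
      rewrite /B inE; case: ifP => [iA _|_ /= ibd]; last exact: Ct.
      by have := fintype.subsetP AS i iA; rewrite finset.in_set.
    split=> [|i /= ibd].
      apply/box_successes/fintype.subsetP => i iA; rewrite finset.in_set.
      by have := Bt i; rewrite /= /B inE iA; apply.
    have := Bt i; rewrite /= /B inE ibd orbT.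
    by rewrite (disjointFl (disjoint_boundary N A) ibd); apply.
  rewrite X_indep; last first.
    move=> i; rewrite /B; case: ifP => _.
      exact: measurable_success_values.
    exact: measurable_failure_values.
  rewrite prod_half => [|i _]; last first.
    by rewrite /B; case: ifP => _; [apply: X_success|apply: prob_failure].
  rewrite -exprD cardsU (_ : A :&: _ = finset.set0) ?cards0 ?subn0 //.
  by apply/eqP; rewrite finset.setI_eq0 disjoint_boundary.
have := p_def A blockA; rewrite /cond_prob lightE P_light P_run /= => <-.
have half0 n : (2^-1 : R) ^+ n != 0 by rewrite expf_neq0 // invr_neq0 // pnatr_eq0.
rewrite -[LHS]fineK ?fin_num_measure //; congr _%:E.
by field; rewrite !half0.
Qed.

Definition light_configuration (S : {set 'I_N}) : set Omega :=
  [set t | successes X mu t = S /\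
     forall A, is_success_run S A -> run_weight X w A t < Tobs].

Lemma light_configurationE S :
  light_configuration S =
  (\big[setI/setT]_(A <- enum (is_success_run S)) (observations X A @^-1` light_values A))
  `&` \bigcap_(i in [set` ~: S]) (X i @^-1` failure_values i).
Proof.
rewrite -bigcap_seq; apply/seteqP; split=> [t [St lightt]|t [lightt failt]].
  split=> [A /=|]; last first.
    apply/coordinates_failures; rewrite St -finset.setI_eq0.
    by rewrite finset.setIC finset.setICr.
  rewrite mem_enum => runA; split; last exact: lightt.
  by apply/box_successes; rewrite St; have /maxsetp/andP[] := runA.
split=> [|A runA]; last by have [] := lightt A; rewrite /= ?mem_enum.
apply/setP=> i; apply/idP/idP => [|iS].
  move/coordinates_failures: failt => /disjointFl disj /disj.
  by rewrite inE => /negbFE.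
have [A runA iA] := success_in_run _ _ _ iS.
have [|/box_successes/fintype.subsetP AS _] := lightt A; first by rewrite /= mem_enum.
exact: AS.
Qed.

Lemma run_block (S A : {set 'I_N}) : is_success_run S A -> block A.
Proof. by move/maxsetp/andP=> []. Qed.

Lemma measurable_light_configuration S : measurable (light_configuration S).
Proof.
rewrite light_configurationE; apply: measurableI.
  rewrite big_seq; apply: bigsetI_measurable => A; rewrite mem_enum => runA.
  rewrite -[X in measurable X]setTI; apply: measurable_observations => //.
  by apply: measurable_light_values; apply: run_block runA.
by apply: coordinates_measurable; apply: measurable_failure_values.
Qed.

Lemma prob_light_configuration S :
  P (light_configuration S) =
  (2^-1 ^+ N * \prod_(A : {set 'I_N} | is_success_run S A) p #|A|)%:E.
Proof.
rewrite light_configurationE independent_groups //; first last.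
- apply/allP => A; rewrite mem_enum => /maxsetp/andP[_ AS].
  by rewrite -finset.setI_eq0 -finset.setDE finset.setD_eq0.
- have := enum_uniq (is_success_run S); rewrite uniq_pairwise.
  apply: sub_in_pairwise (allss _) => A B; rewrite !mem_enum => runA runB.
  exact: disjoint_runs runA runB.
- exact: measurable_failure_values.
- by move=> A; rewrite mem_enum => /run_block; apply: measurable_light_values.
rewrite prod_half => [|i _]; last exact: prob_failure.
rewrite big_enum /=.
rewrite (eq_bigr (fun A : {set 'I_N} => (p #|A| * 2^-1 ^+ #|A|)%:E)); last first.
  by move=> A /run_block; apply: prob_light.
rewrite prodEFin -EFinM big_split /=; congr _%:E.
(* The lengths of the runs of S add up to the sum of its gaps, which is #|S|. *)
have -> : \prod_(A : {set 'I_N} | is_success_run S A) (2^-1 : R) ^+ #|A| = 2^-1 ^+ #|S|.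
  rewrite (prod_runs _ (fun x => 2^-1 ^+ x)) -sumn_run_gaps.
  elim: (run_gaps N S) => [|x c IHc]; first by rewrite big_nil.
  by rewrite big_cons IHc /= exprD; case: eqP => [->|].
by rewrite -mulrA -exprD cardsC card_ord mulrC.
Qed.

Lemma prob_some_success : P (some_success X mu) = (1 - 2^-1 ^+ N)%:E.
Proof.
pose F := \bigcap_(i in [set` [set: 'I_N]%SET]) (X i @^-1` failure_values i).
have -> : some_success X mu = ~` F.
  apply/seteqP; split=> [t [i success_i] /(_ i)|t notF].
    by rewrite /failure_values /= inE leNgt success_i => /(_ isT).
  apply: contrapT => none; apply: notF => i _ /=.
  by rewrite /failure_values /= leNgt; apply/negP => success_i; apply: none; exists i.
rewrite probability_setC; last by apply: coordinates_measurable; apply: measurable_failure_values.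
rewrite X_indep; last exact: measurable_failure_values.
rewrite prod_half => [|i _]; last exact: prob_failure.
by rewrite cardsT card_ord -EFinB.
Qed.

Lemma prob_light_and_success :
  P ([set t | (max_run_weight X mu w t < Tobs%:E)%E] `&` some_success X mu) =
  (\sum_(S : {set 'I_N} | S != finset.set0)
     2^-1 ^+ N * \prod_(A : {set 'I_N} | is_success_run S A) p #|A|)%:E.
Proof.
pose u := enum (fun S : {set 'I_N} => S != finset.set0).
have -> : [set t | (max_run_weight X mu w t < Tobs%:E)%E] `&` some_success X mu =
    \bigcup_(S in [set` u]) light_configuration S.
  apply/seteqP; split=> [t [/bigmax_ltP[_ light_t] [i success_i]]|t [S /= uS [St light_t]]].
    exists (successes X mu t); last first.
      by split=> // A runA; have := light_t A runA; rewrite lte_fin.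
    by rewrite /= mem_enum; apply/set0Pn; exists i; rewrite finset.in_set.
  split.
    apply/bigmax_ltP; split; first exact: ltNyr.
    by move=> A runA; rewrite lte_fin; apply: light_t; rewrite -St.
  move: uS; rewrite mem_enum -St => /set0Pn[i]; rewrite finset.in_set => success_i.
  by exists i.
rewrite measure_fin_bigcup //; last first.
- by move=> S _; apply: measurable_light_configuration.
- by move=> S S' _ _ [t [[<- _] [<- _]]].
rewrite -fsbig_seq ?enum_uniq //= /u big_enum /= -sumEFin.
by apply: eq_bigr => S _; apply: prob_light_configuration.
Qed.

End Configurations.

(** * Distribution of the largest run weight *)

Theorem mainTheorem1 (d : measure_display) (Omega : measurableType d)
    (R : realType) (P : probability Omega R)
    (N : nat) (N_gt0 : (0 < N)%N)
    (X : 'I_N -> {RV P >-> R}) (mu : 'I_N -> R)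
    (X_indep : mutually_independent X)
    (X_mean : forall i : 'I_N, ('E_P[X i] = (mu i)%:E)%E)
    (X_success : forall i : 'I_N, P [set t | mu i < X i t] = (2^-1)%:E)
    (w : forall A : {set 'I_N}, #|A|.-tuple R -> R)
    (w_meas : forall A : {set 'I_N}, block A -> measurable_fun setT (w A))
    (Tobs : R)
    (p : nat -> R)
    (p_def : forall A : {set 'I_N}, block A ->
       cond_prob P [set t | run_weight X w A t < Tobs]
                   (success_run_event X mu A) = p #|A|) :
  cond_prob P [set t | (max_run_weight X mu w t < Tobs%:E)%E]
              (some_success X mu) =
  \sum_(1 <= r < N.+1)
    \sum_(1 <= M < (minn r (N - r + 1)).+1)
      \sum_(s : M.-tuple 'I_r.+1 | is_partition s)
        (\prod_(1 <= l < N.+1) p l ^+ multiplicity s l) *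
        (pochhammer R (N - r + 2 - M) M /
         ((2 ^+ N - 1) * \prod_(1 <= l < N.+1) ((multiplicity s l)`!)%:R)).
Proof.
have pow_gt1 : (1 : R) < 2 ^+ N by rewrite exprn_egt1 // ?ltr1n // -lt0n.
rewrite /cond_prob (prob_light_and_success _ _ _ _ _ _ _ _ _ _ X_indep X_success w_meas p_def).
rewrite (prob_some_success _ _ _ _ _ _ _ X_indep X_success) /=.
rewrite -mulr_sumr sum_nonempty_sets.
have -> (x : R) : 2^-1 ^+ N * x / (1 - 2^-1 ^+ N) = (2 ^+ N - 1)^-1 * x.
  rewrite exprVn; field.
  by rewrite ?expf_neq0 ?subr_eq0 ?(gt_eqF pow_gt1) ?(lt_eqF pow_gt1) ?pnatr_eq0.
rewrite mulr_sumr; apply: eq_bigr => r _.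
rewrite mulr_sumr; apply: eq_bigr => M _.
rewrite mulr_sumr; apply: eq_bigr => s _.
by rewrite invfM [LHS]mulrCA; congr (_ * _); rewrite mulrCA.
Qed.
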